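(* Let $S$ be a proper sampling on $[n]$ with $p_i=\mathbb{P}[i\in S]$ and weights $\theta_S^i=1/p_i$. Let each $f_i:\mathbb{R}^d\to\mathbb{R}$ be $L_i$-smooth and convex, and let $f=\frac1n\sum_{i=1}^nf_i$ be $L_f$-smooth and convex. Let $\mathcal{L}_1$ be the expected smoothness constant defined in the context. (i) If $S$ is the $\tau$-nice sampling, then $$\mathcal{L}_1\le\frac{n(\tau-1)}{\tau(n-1)}L_f+\frac{n-\tau}{\tau(n-1)}\max_{i}\{L_i\}.$$ (ii) If $S$ is a group sampling, and $\mathcal{I}$ denotes the set of isolated indices, then $$\mathcal{L}_1\le L_f+\frac1n\max\left\{\max_{i\in\mathcal{I}}\left(\frac{1}{p_i}-1\right)L_i,\ \max_{i\notin\mathcal{I}}\frac{L_i}{p_i}\right\}.$$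
   Context: $[n]=\{1,\dots,n\}$; $e\in\mathbb{R}^n$ is the all-ones vector. $\psi:\mathbb{R}^d\to\mathbb{R}\cup\{+\infty\}$ is proper closed convex; $x^*$ is a fixed global minimizer of $P=f+\psi$ (assumed to exist). $L$-smooth means differentiable with $L$-Lipschitz gradient. A maximum over an empty index set is omitted. A sampling is a random subset $S$ of $[n]$; it is proper if $\mathbb{P}[i\in S]>0$ for all $i$. $\tau$-nice sampling: $S$ is a uniformly random subset of $[n]$ of cardinality $\tau$, so $p_i=\tau/n$ and $\mathbb{P}[i\in S\ \&\ j\in S]=\frac{\tau(\tau-1)}{n(n-1)}$ for $i\ne j$. Group sampling: numbers $p_i\in(0,1]$ are given; $[n]$ is partitioned into groups $C_1,\dots,C_t$ with $\sum_{i\in C_j}p_i\le1$ for every $j$; independently over groups, with probability $\sum_{i\in C_j}p_i$ exactly one index is chosen from $C_j$ (otherwise none), the chosen index being $i\in C_j$ with probability $p_i/\sum_{s\in C_j}p_s$. $S$ is the set of chosen indices, so $\mathbb{P}[i\in S]=p_i$. An index $i$ is isolated if $\{i\}$ is itself one of the groups. $\theta_S$ is the diagonal matrix with entries $\theta_S^i$, $\mathbf{I}_S$ is the diagonal $0/1$ indicator matrix of $S$, and $\mathbf{G}(x)=[\nabla f_1(x),\dots,\nabla f_n(x)]$, so $\frac1n\mathbf{G}(x)\theta_S\mathbf{I}_Se=\frac1n\sum_{i\in S}\theta_S^i\nabla f_i(x)$. $\mathcal{L}_1$ is the smallest constant such that for all $x\in\mathbb{R}^d$: $\mathbb{E}\left[\|\frac1n(\mathbf{G}(x)-\mathbf{G}(x^*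 ))\theta_S\mathbf{I}_Se\|^2\right]\le2\mathcal{L}_1(f(x)-f(x^* )-\langle\nabla f(x^* ),x-x^*\rangle)$. *)

(* Defs.v *)
From HB Require Import structures.
From mathcomp Require Import all_boot all_order all_algebra.
From mathcomp Require Import all_classical all_reals all_analysis.

Set Implicit Arguments.
Unset Strict Implicit.
Unset Printing Implicit Defensive.

Import Order.TTheory GRing.Theory Num.Theory.
Import numFieldNormedType.Exports.

Local Open Scope classical_set_scope.
Local Open Scope ring_scope.

(* R^d is 'cV[R]_d.  The library norm on matrices is the sup norm, so the
   Euclidean inner product and norm are introduced here; differentiability is
   the library's, which does not depend on the choice of norm on R^d. *)
Section Euclidean.
Context {R : realType} {d : nat}.
Implicit Types (x y : 'cV[R]_d) (f : 'cV[R]_d -> R).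

Definition dotp x y : R := \sum_(i < d) x i 0 * y i 0.
Definition enorm x : R := Num.sqrt (dotp x x).

Definition grad f x : 'cV[R]_d := \col_(i < d) 'D_(delta_mx i 0) f x.

Definition smooth (L : R) f : Prop :=
  [/\ 0 <= L,
      forall x, differentiable f x
    & forall x y, enorm (grad f x - grad f y) <= L * enorm (x - y)].

Definition bregman f x y : R := f x - f y - dotp (grad f y) (x - y).

End Euclidean.

Section ProperClosedConvex.
Context {R : realType} {d : nat}.
Implicit Types psi : 'cV[R]_d -> \bar R.
Local Open Scope ereal_scope.

Definition proper_fun psi : Prop :=
  (forall x, -oo < psi x) /\ (exists x, psi x < +oo).

Definition closed_fun psi : Prop :=
  closed [set xr : 'cV[R]_d * R | psi xr.1 <= xr.2%:E].

(* The library's convention 0 * +oo = 0 makes t = 0 and t = 1 harmless. *)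
Definition econvex psi : Prop :=
  forall x y (t : R), (0 <= t <= 1)%R ->
    psi (t *: x + (1 - t) *: y)%R <= t%:E * psi x + (1 - t)%:E * psi y.

Definition global_minimizer (F : 'cV[R]_d -> \bar R) xs : Prop :=
  forall x, F xs <= F x.

End ProperClosedConvex.

Section Average.
Context {R : realType} {d n : nat}.
Variable f : 'I_n -> 'cV[R]_d -> R.

Definition avg_fun (x : 'cV[R]_d) : R := n%:R^-1 * \sum_(i < n) f i x.

Definition grad_mx (x : 'cV[R]_d) : 'M[R]_(d, n) :=
  \matrix_(k < d, i < n) grad (f i) x k 0.

End Average.

Section Sampling.
Context {d : measure_display} {T : measurableType d} {R : realType}.
Variable P : probability T R.

(* The values of S lie in a finite type, so measurability is measurability of
   the fibres. *)
Definition random_subset n (S : T -> {set 'I_n}) : Prop :=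
  forall A : {set 'I_n}, measurable [set w | S w = A].

(* Mutual independence of the family (X i)_(i in D) of finitely valued random
   variables: the product rule over every subfamily. *)
Definition mutually_independent (I U : finType) (D : {set I})
    (X : I -> T -> U) : Prop :=
  forall (J : {set I}) (A : I -> {set U}), J \subset D ->
    P [set w | forall i, i \in J -> X i w \in A i] =
    (\prod_(i in J) P [set w | X i w \in A i])%E.

Definition nice_sampling n (tau : nat) (S : T -> {set 'I_n}) : Prop :=
  forall A : {set 'I_n},
    P [set w | S w = A] = (if #|A| == tau then 'C(n, tau)%:R^-1 else 0)%:E.

Definition group_sampling n (p : 'I_n -> R) (C : {set {set 'I_n}})
    (S : T -> {set 'I_n}) : Prop :=
  [/\ forall i, 0 < p i <= 1,
      finset.partition C [set: 'I_n]%SET /\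
        (forall B, B \in C -> \sum_(i in B) p i <= 1),
      mutually_independent C (fun B w => S w :&: B),
      forall B i, B \in C -> i \in B ->
        P [set w | S w :&: B = [set i]%SET] =
        ((\sum_(s in B) p s) * (p i / \sum_(s in B) p s))%:E
    & forall B, B \in C ->
        P [set w | S w :&: B = finset.set0] = (1 - \sum_(s in B) p s)%:E].

Definition isolated_index n (C : {set {set 'I_n}}) (i : 'I_n) : bool :=
  [set i]%SET \in C.

End Sampling.

Section ExpectedSmoothness.
Context {dT : measure_display} {T : measurableType dT} {R : realType}.
Context {d n : nat}.
Variables (P : probability T R) (S : T -> {set 'I_n}).
Variables (theta : {set 'I_n} -> 'I_n -> R).
Variables (f : 'I_n -> 'cV[R]_d -> R) (xs : 'cV[R]_d).

(* (1/n) (G(x) - G(xs)) theta_A I_A e *)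
Definition sampled_diff (A : {set 'I_n}) (x : 'cV[R]_d) : 'cV[R]_d :=
  n%:R^-1 *: ((grad_mx f x - grad_mx f xs)
                *m diag_mx (\row_i theta A i)
                *m diag_mx (\row_i (i \in A)%:R)
                *m const_mx 1).

Definition smoothness_constants : set R :=
  [set c : R | 0 <= c /\ forall x : 'cV[R]_d,
    ('E_P[fun w => (enorm (sampled_diff (S w) x) ^+ 2)%R] <=
     (2 * c * bregman (avg_fun f) x xs)%:E)%E].

(* The smallest admissible constant, as an extended real: it is +oo when no
   constant is admissible, and otherwise the infimum is attained
   (expected_smoothness_min).  Constants are taken nonnegative so that a
   smallest one exists even when both sides of the inequality vanish for
   all x. *)
Definition expected_smoothness : \bar R :=
  ereal_inf [set c%:E | c in smoothness_constants].

Lemma expected_smoothness_min : smoothness_constants !=set0 ->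
  exists2 c, smoothness_constants c & expected_smoothness = c%:E.
Proof.
move=> S0; set K := smoothness_constants.
have lbK : has_lbound K by exists 0 => c [].
have infK : has_inf K by split.
have i0 : 0 <= inf K by apply: lb_le_inf => // c [].
exists (inf K); last by rewrite /expected_smoothness ereal_inf_EFin.
split=> // x; set E := ('E_P[_])%E; set b := bregman _ _ _.
apply/lee_addgt0Pr => e e0.
have M0 : 0 < 2 * `|b| + 1 by rewrite ltr_wpDl // mulr_ge0.
have [c [c0 Kc] ltc] := inf_adherent (divr_gt0 e0 M0) infK.
apply: le_trans (Kc x) _; rewrite -/b -EFinD lee_fin.
rewrite -lerBlDl -mulrBl -mulrBr.
have cK : 0 <= c - inf K by rewrite subr_ge0; exact: ge_inf.
apply: (@le_trans _ _ ((c - inf K) * (2 * `|b| + 1))).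
  rewrite -mulrA mulrCA ler_wpM2l //.
  by apply: (@le_trans _ _ (2 * `|b|)); [rewrite ler_pM2l // ler_norm | rewrite lerDl].
by rewrite -ler_pdivlMr // lerBlDl ltW.
Qed.

End ExpectedSmoothness.

(* Main.v *)
Require Import Defs.
From mathcomp Require Import all_boot all_order all_algebra.
From mathcomp Require Import all_classical all_reals all_analysis.
From mathcomp Require Import measurable_realfun ring lra.

Set Implicit Arguments.
Unset Strict Implicit.
Unset Printing Implicit Defensive.

Import Order.TTheory GRing.Theory Num.Theory.
Import numFieldNormedType.Exports.

Local Open Scope classical_set_scope.
Local Open Scope ring_scope.

(** Write [g i] for [grad (f i) x - grad (f i) xs] and [b i] for the Bregman
    distance [f i x - f i xs - <grad (f i) xs, x - xs>]. Expanding the square,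
    the quantity bounded by the expected smoothness constant is
      [n^-2 * \sum_i \sum_j P(i \in S, j \in S) / (p i * p j) * <g i, g j>],
    and only the probabilities of joint inclusion of pairs of indices matter.

    For both samplings this quadratic form is at most
      [alpha * |\sum_i g i|^2 + \sum_i beta i * |g i|^2]
    with [alpha] and [beta] nonnegative. For the nice sampling the joint
    probabilities take one value on the diagonal and one off it, and there is
    equality with [alpha = n (tau - 1) / (tau (n - 1))] and
    [beta i = n (n - tau) / (tau (n - 1))]. For a group sampling the
    coefficients are [1 / p i] on the diagonal, [1] between different groups
    and [0] between distinct indices of one group. Comparing with the all-ones
    matrix ([alpha = 1]), what remains is the sum of [|g i|^2 / p i] minus
    the sum over the groups of [|\sum_(i in B) g i|^2]. The latter is dropped for
    groups of several indices and kept for the isolated ones, whence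
    [beta i = 1 / p i - 1] or [1 / p i] ([group_quadratic_le]).

    Both parts are then bounded by co-coercivity of the gradient of a convex
    smooth function ([grad_sqr_le_bregman]): [|g i|^2 <= 2 * L i * b i], and
    the average of the [g i] has squared norm at most [2 * Lf * b], where [b]
    is the average of the [b i]. This is [expected_smoothness_le]. *)

(** * Smooth convex functions on Euclidean space *)

Section EuclideanTheory.
Context {R : realType} {d : nat}.
Implicit Types (x y z h g : 'cV[R]_d) (f : 'cV[R]_d -> R).

Lemma dotpC x y : dotp x y = dotp y x.
Proof. by apply: eq_bigr => i _; rewrite mulrC. Qed.

Lemma dotpDl x y z : dotp (x + y) z = dotp x z + dotp y z.
Proof. by rewrite -big_split; apply: eq_bigr => i _; rewrite mxE mulrDl. Qed.

Lemma dotpZl (a : R) x z : dotp (a *: x) z = a * dotp x z.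
Proof. by rewrite mulr_sumr; apply: eq_bigr => i _; rewrite mxE mulrA. Qed.

Lemma dotpNl x z : dotp (- x) z = - dotp x z.
Proof. by rewrite -scaleN1r dotpZl mulN1r. Qed.

Lemma dotp_suml (I : finType) (Q : pred I) (F : I -> 'cV[R]_d) z :
  dotp (\sum_(i | Q i) F i) z = \sum_(i | Q i) dotp (F i) z.
Proof.
elim/big_rec2: _ => [|i a b _ <-]; last by rewrite dotpDl.
by rewrite /dotp big1 // => i _; rewrite mxE mul0r.
Qed.

Lemma dotpDr x y z : dotp z (x + y) = dotp z x + dotp z y.
Proof. by rewrite !(dotpC z) dotpDl. Qed.

Lemma dotpZr (a : R) x z : dotp z (a *: x) = a * dotp z x.
Proof. by rewrite !(dotpC z) dotpZl. Qed.

Lemma dotpNr x z : dotp z (- x) = - dotp z x.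
Proof. by rewrite !(dotpC z) dotpNl. Qed.

Lemma dotp_sumr (I : finType) (Q : pred I) (F : I -> 'cV[R]_d) z :
  dotp z (\sum_(i | Q i) F i) = \sum_(i | Q i) dotp z (F i).
Proof. by rewrite dotpC dotp_suml; apply: eq_bigr => i _; rewrite dotpC. Qed.

Lemma dotp_ge0 x : 0 <= dotp x x.
Proof. by apply: sumr_ge0 => i _; rewrite -expr2 sqr_ge0. Qed.

Lemma dotp_eq0 x : dotp x x = 0 -> x = 0.
Proof.
move=> x0; apply/colP => i; rewrite mxE; apply/eqP.
rewrite -sqrf_eq0 expr2; apply/eqP; move: i (erefl true).
by apply: psumr_eq0P x0 => i _; rewrite -expr2 sqr_ge0.
Qed.

Lemma enorm_sqr x : enorm x ^+ 2 = dotp x x.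
Proof. by rewrite sqr_sqrtr // dotp_ge0. Qed.

Lemma enorm_ge0 x : 0 <= enorm x.
Proof. exact: sqrtr_ge0. Qed.

(** A form of the Cauchy-Schwarz inequality: a vector at most [c] times as long
    as [h] has inner product at most [c * |h|^2] with [h]. *)
Lemma dotp_le_of_enorm (c : R) x h : 0 <= c -> enorm x <= c * enorm h ->
  dotp x h <= c * dotp h h.
Proof.
move=> c0 xh.
have {xh} xh : dotp x x <= c ^+ 2 * dotp h h.
  rewrite -!enorm_sqr -exprMn ler_sqr // ?nnegrE ?mulr_ge0 ?enorm_ge0 //.
(* Expand 0 <= |x - c h|^2 and divide by c; if c = 0 then x = 0. *)
have := dotp_ge0 (x - c *: h).
rewrite dotpDl !dotpDr !dotpNl !dotpNr !dotpZl !dotpZr (dotpC h x) => sq.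
move: c0; rewrite le_eqVlt => /predU1P[c0|c0]; last first.
  by rewrite -(ler_pM2l c0); nra.
move: xh; rewrite -c0 expr0n /= !mul0r => x0.
have -> : x = 0 by apply/dotp_eq0/le_anti; rewrite x0 dotp_ge0.
by rewrite -[X in dotp X](scale0r h) dotpZl mul0r.
Qed.

Lemma derive_grad f x h : differentiable f x -> 'D_h f x = dotp (grad f x) h.
Proof.
move=> dfx; rewrite deriveE //.
have {1}-> : h = \sum_(i < d) h i 0 *: delta_mx i 0.
  by rewrite {1}[h]matrix_sum_delta; apply: eq_bigr => i _; rewrite big_ord1.
rewrite linear_sum /=; apply: eq_bigr => i _.
by rewrite linearZ /= /grad mxE deriveE // mulrC.
Qed.

(** The chain rule along the line through [x] with direction [h]: the two
    difference quotients are the same function. *)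
Lemma is_derive_line f x h (t : R) : differentiable f (x + t *: h) ->
  is_derive t 1 (fun s : R => f (x + s *: h)) (dotp (grad f (x + t *: h)) h).
Proof.
move=> dfx.
have E : (fun s : R => s^-1 *: (((fun s : R => f (x + s *: h)) \o shift t) (s *: 1)
            - f (x + t *: h))) =
         (fun s : R => s^-1 *: ((f \o shift (x + t *: h)) (s *: h) - f (x + t *: h))).
  apply/funext => s /=; congr (_ *: (f _ - _)).
  by rewrite scalerDl [s *: 1]mulr1 addrCA.
split; first by rewrite /derivable E; exact: (@diff_derivable _ _ _ f _ h dfx).
by rewrite -(derive_grad h dfx) /derive E.
Qed.

Lemma gradN f x : differentiable f x -> grad (fun z => - f z) x = - grad f x.
Proof.
move=> dfx; apply/colP => i; rewrite !mxE -deriveN //.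
exact: diff_derivable.
Qed.

Lemma smoothN (L : R) f : smooth L f -> smooth L (fun z => - f z).
Proof.
case=> L0 df Lf; split; first by [].
  by move=> x; have /differentiableN := df x.
move=> x y; rewrite !gradN // -opprD /enorm dotpNl dotpNr opprK; exact: Lf.
Qed.

(** The descent lemma: along a segment, the derivative of the gap between [f]
    and its quadratic model at [x] is nonpositive. *)
Lemma smooth_upper (L : R) f x h : smooth L f ->
  f (x + h) <= f x + dotp (grad f x) h + L / 2 * dotp h h.
Proof.
case=> L0 df Lf.
pose G (t : R) : R :=
  f (x + t *: h) - (t * dotp (grad f x) h + L / 2 * dotp h h * t ^+ 2).
pose G' (t : R) : R :=
  dotp (grad f (x + t *: h)) h - (dotp (grad f x) h + L * dotp h h * t).
have dG (t : R) : is_derive t 1 G (G' t).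
  have := is_derive_line (df (x + t *: h)) => dl.
  rewrite /G; apply: is_derive_eq.
  rewrite /G' scaler0 add0r; congr (_ - (_ + _)); first exact: mulr1.
  by rewrite /GRing.scale /= /GRing.scale /=; field.
have dGd (t : R) : derivable G t 1 by apply: ex_derive.
have cG : {within `[0, 1], continuous G}.
  apply: continuous_subspaceT => t.
  exact/differentiable_continuous/derivable1_diffP.
have G'0 (t : R) : t \in `]0, 1[%R -> derive1 G t <= 0.
  rewrite in_itv /= => /andP[t0 _]; rewrite derive1E (@derive_val _ _ _ _ _ _ _ (dG t)).
  rewrite /G' opprD addrA subr_le0 -dotpNl -dotpDl mulrAC.
  apply: dotp_le_of_enorm; first by rewrite mulr_ge0 // ltW.
  apply: le_trans (Lf _ _) _; rewrite addrAC subrr add0r.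
  suff -> : enorm (t *: h) = t * enorm h by rewrite mulrA.
  by rewrite /enorm dotpZl dotpZr mulrA -expr2 sqrtrM ?sqr_ge0 // sqrtr_sqr ger0_norm // ltW.
have := @ler0_derive1_le_cc _ G 0 1 (fun t _ => dGd t) G'0 cG 1 0.
rewrite !in_itv /= !lexx !ler01 => /(_ isT isT isT).
rewrite /G scale0r addr0 scale1r expr0n /= expr1n !mul0r !mulr0 addr0 subr0 mulr1 mul1r.
lra.
Qed.

(** The descent lemma for [- f]. *)
Lemma smooth_lower (L : R) f x h : smooth L f ->
  f x + dotp (grad f x) h - L / 2 * dotp h h <= f (x + h).
Proof.
move=> Lf; have [_ df _] := Lf.
have := smooth_upper x h (smoothN Lf); rewrite gradN // dotpNl; lra.
Qed.

(** The first-order condition for convexity. For [0 < t <= 1], convexity bounds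
    [f (x + h) - f x] below by [(f (x + t *: h) - f x) / t], and smoothness
    bounds this below by [<grad f x, h> - t * L / 2 * |h|^2]; as [t] can be
    arbitrarily small, no limit of difference quotients is needed. *)
Lemma convex_grad_le (L : R) f x h : smooth L f ->
  convex_function [set: 'cV[R]_d] f -> f x + dotp (grad f x) h <= f (x + h).
Proof.
move=> Lf cf; have [L0 _ _] := Lf.
apply/ler_addgt0Pr => e e0.
have M0 : 0 < L / 2 * dotp h h + 1.
  by rewrite ltr_wpDl // mulr_ge0 ?dotp_ge0 // divr_ge0.
(* A step small enough for the error term t * L / 2 * |h|^2 to be at most e. *)
pose t : R := Num.min 1 (e / (L / 2 * dotp h h + 1)).
have t0 : 0 < t by rewrite lt_min ltr01 divr_gt0.
have t1 : t <= 1 by rewrite ge_min lexx.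
have te : t * (L / 2 * dotp h h + 1) <= e.
  by rewrite -ler_pdivlMr // ge_min lexx orbT.
have t01 : 0 <= t <= 1 by rewrite ltW.
have := smooth_lower x (t *: h) Lf; rewrite dotpZr dotpZl dotpZr => lo.
have up : f (x + t *: h) <= t * f (x + h) + (1 - t) * f x.
  have := cf (Itv01 (ltW t0) t1) (x + h) x (in_setT _) (in_setT _).
  set c := conv _ _ _; set v := conv _ _ _.
  have -> : c = x + t *: h.
    rewrite /c /conv /= scalerDr scalerBl scale1r /=.
    by rewrite addrC addrA subrK.
  by [].
rewrite -(ler_pM2l t0); nra.
Qed.

(** Co-coercivity of the gradient. For [0 < L], with [g = grad f x - grad f y],
    the point [x - g / L] is a gradient step from [x] for the convex function
    [f - <grad f y, .>], which is minimal at [y]; the step decreases this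
    function by at least [|g|^2 / (2 L)]. *)
Lemma grad_sqr_le_bregman (L : R) f x y : smooth L f ->
  convex_function [set: 'cV[R]_d] f ->
  dotp (grad f x - grad f y) (grad f x - grad f y) <= 2 * L * bregman f x y.
Proof.
move=> Lf cf; have [L0 _ LipL] := Lf; rewrite /bregman.
move gdef : (grad f x - grad f y) => g.
move: (L0); rewrite le_eqVlt => /predU1P[L00|Lp].
  (* For L = 0 the gradient is constant and both sides vanish. *)
  have := LipL x y; rewrite gdef -L00 mul0r => g0.
  rewrite mulr0 mul0r -enorm_sqr; have := enorm_ge0 g => g1.
  have -> : enorm g = 0 by apply/le_anti; rewrite g0 g1.
  by rewrite expr0n.
have := smooth_upper x (- L^-1 *: g) Lf.
have := convex_grad_le y (x - y + - L^-1 *: g) Lf cf.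
rewrite addrA [y + _]addrC subrK !(dotpDr, dotpZr, dotpZl) => lo up.
have gE : dotp g g = dotp (grad f x) g - dotp (grad f y) g
  by rewrite -{1}gdef dotpDl dotpNl.
rewrite -ler_pdivrMl ?mulr_gt0 // invfM.
have Lv : L / 2 * (- L^-1 * (- L^-1 * dotp g g)) = 2^-1 * L^-1 * dotp g g.
  by field; rewrite gt_eqF.
rewrite Lv in up; move: lo up; rewrite gE; set u := L^-1; lra.
Qed.

End EuclideanTheory.

(** * Random variables with finitely many values *)

Section FiniteLaw.
Context {dT : measure_display} {T : measurableType dT} {R : realType}.
Variables (P : probability T R) (U : finType) (X : T -> U).
Hypothesis mX : forall a : U, measurable [set w | X w = a].

(** The probability mass function of [X], with real values. *)
Definition law (a : U) : R := fine (P [set w | X w = a]).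

Lemma lawE a : P [set w | X w = a] = (law a)%:E.
Proof. by rewrite fineK // fin_num_measure. Qed.

Lemma law_ge0 a : 0 <= law a.
Proof. exact: fine_ge0. Qed.

Lemma expectation_finite_valued (F : U -> R) : (forall a, 0 <= F a) ->
  ('E_P[fun w => F (X w)])%E = (\sum_a F a * law a)%:E.
Proof.
move=> F0; rewrite unlock.
have E w : ((F (X w))%:E = \sum_(a : U) (F a)%:E * (\1_[set w | X w = a] w)%:E)%E.
  rewrite (bigD1 (X w)) //= big1 => [|a aX].
    by rewrite adde0 indicE mem_set // mule1.
  by rewrite indicE memNset ?mule0 // => /esym/eqP; rewrite (negbTE aX).
under eq_integral => w _ do rewrite E.
rewrite ge0_integral_sum //; last 2 first.
- move=> a; apply: measurable_funeM; apply/measurable_EFinP.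
  exact: measurable_indic.
- by move=> a w _; rewrite -EFinM lee_fin mulr_ge0.
rewrite -sumEFin; apply: eq_bigr => a _.
rewrite ge0_integralZl_EFin //; last by apply/measurable_EFinP; exact: measurable_indic.
by rewrite integral_indic // setIT EFinM; congr (_ * _)%E; exact: lawE.
Qed.

Lemma prob_finite_valued (Q : pred U) :
  P [set w | Q (X w)] = (\sum_(a | Q a) law a)%:E.
Proof.
have := @expectation_finite_valued (fun a => (Q a)%:R) (fun a => ler0n _ _).
have -> : (fun w => (Q (X w))%:R) = \1_[set w | Q (X w)] :> (T -> R).
  by apply/funext => w; rewrite indicE; congr (nat_of_bool _)%:R; apply/esym; exact: asboolb.
rewrite expectation_indic => [->|].
  congr EFin; rewrite [RHS]big_mkcond; apply: eq_bigr => a _.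
  by case: (Q a); rewrite ?mul1r ?mul0r.
have -> : [set w | Q (X w)] = \bigcup_(a in [set` Q]) [set w | X w = a].
  by apply/seteqP; split => [w Qw|w [a Qa /= ->] //]; exists (X w).
apply: fin_bigcup_measurable => //; exact: finite_finset.
Qed.

End FiniteLaw.

(** * Expected smoothness from pairwise inclusion probabilities *)

Section Average.
Context {R : realType} {d n : nat}.
Variables (f : 'I_n -> 'cV[R]_d -> R).
Hypothesis df : forall i x, differentiable (f i) x.

Lemma grad_avg x : grad (avg_fun f) x = n%:R^-1 *: \sum_(i < n) grad (f i) x.
Proof.
apply/colP => k; rewrite !mxE summxE.
have dfk i : derivable (f i) x (delta_mx k 0) by exact: diff_derivable.
have -> : avg_fun f = n%:R^-1 *: (\sum_(i < n) f i).
  by apply/funext => z; rewrite fctE fct_sumE.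
rewrite deriveZ; last exact: derivable_sum.
rewrite derive_sum //; congr (_ * _).
by apply: eq_bigr => i _; rewrite mxE.
Qed.

Lemma bregman_avg x y :
  bregman (avg_fun f) x y = n%:R^-1 * \sum_(i < n) bregman (f i) x y.
Proof.
rewrite /bregman grad_avg dotpZl dotp_suml /avg_fun -!mulrBr -!sumrB.
by congr (_ * _).
Qed.

End Average.

Section SecondMoment.
Context {R : realType} {d n : nat}.
Implicit Types (w : {set 'I_n} -> R) (v : 'I_n -> 'cV[R]_d).

(** The probability that both [i] and [j] are sampled, for a sampling that
    takes the value [A] with probability [w A]. *)
Definition pair_incl w (i j : 'I_n) : R :=
  \sum_(A : {set 'I_n} | (i \in A) && (j \in A)) w A.

Lemma second_moment_pair_incl w v :
  \sum_(A : {set 'I_n}) dotp (\sum_(i in A) v i) (\sum_(i in A) v i) * w A =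
  \sum_i \sum_j pair_incl w i j * dotp (v i) (v j).
Proof.
under eq_bigr => A _.
  rewrite dotp_suml mulr_suml big_mkcond /=.
  under eq_bigr => i _.
    (* All pairs (i, j) are summed over, with indicators of membership in A,
       so that the sum over A can be moved inside. *)
    have -> : (if i \in A then dotp (v i) (\sum_(j in A) v j) * w A else 0) =
        \sum_j (if (i \in A) && (j \in A) then w A else 0) * dotp (v i) (v j).
      case: (i \in A); last by rewrite big1 // => j _; rewrite mul0r.
      rewrite dotp_sumr mulr_suml big_mkcond /=; apply: eq_bigr => j _.
      by case: (j \in A); rewrite ?mul0r // mulrC.
    over.
  over.
rewrite exchange_big; apply: eq_bigr => i _; rewrite exchange_big.
by apply: eq_bigr => j _; rewrite -mulr_suml -big_mkcond.
Qed.

Lemma sampled_diffE (theta : {set 'I_n} -> 'I_n -> R) (f : 'I_n -> 'cV[R]_d -> R)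
    xs A x :
  sampled_diff theta f xs A x =
  n%:R^-1 *: \sum_(i in A) theta A i *: (grad (f i) x - grad (f i) xs).
Proof.
rewrite /sampled_diff; congr (_ *: _); apply/colP => k; rewrite mxE summxE [RHS]big_mkcond.
apply: eq_bigr => i _; rewrite !mul_mx_diag !mxE mulr1.
case: (i \in A); first by rewrite mulr1 mulrC.
by rewrite mulr0.
Qed.

End SecondMoment.

Section ExpectedSmoothnessBound.
Context {R : realType} {d n : nat} (n0 : (0 < n)%N).
Variables (f : 'I_n -> 'cV[R]_d -> R) (L : 'I_n -> R) (Lf : R).
Hypotheses (f_smooth : forall i, smooth (L i) (f i))
  (f_convex : forall i, convex_function [set: 'cV[R]_d] (f i))
  (avg_smooth : smooth Lf (avg_fun f))
  (avg_convex : convex_function [set: 'cV[R]_d] (avg_fun f)).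
Context {dT : measure_display} {T : measurableType dT} (P : probability T R).
Variables (S : T -> {set 'I_n}).
Hypothesis S_random : random_subset S.

(** The expected squared norm is [n^-2] times the quadratic form with matrix
    [P(i \in S, j \in S) / (p i * p j)] in the gradient differences. If this form is
    at most [alpha] times the all-ones form plus a diagonal form, co-coercivity
    of the gradient of [avg_fun f] controls the first part and that of the
    gradients of the [f i] the second. *)
Lemma expected_smoothness_le (p : 'I_n -> R) (alpha M : R) (beta : 'I_n -> R)
    (xs : 'cV[R]_d) :
  0 <= alpha -> (forall i, 0 <= beta i) -> 0 <= M ->
  (forall i, beta i * L i <= n%:R * M) ->
  (forall g : 'I_n -> 'cV[R]_d,
    \sum_i \sum_j pair_incl (law P S) i j / (p i * p j) * dotp (g i) (g j) <=
    alpha * dotp (\sum_i g i) (\sum_i g i) + \sum_i beta i * dotp (g i) (g i)) ->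
  (expected_smoothness P S (fun _ i => (p i)^-1)%R f xs <= (alpha * Lf + M)%:E)%E.
Proof.
move=> alpha0 beta0 M0 betaM quad.
have [Lf0 _ _] := avg_smooth.
have df i x : differentiable (f i) x by case: (f_smooth i).
apply: ereal_inf_lbound; exists (alpha * Lf + M) => //; split=> [|x].
  by rewrite addr_ge0 // mulr_ge0.
rewrite (@expectation_finite_valued _ _ _ P _ S S_random
  (fun A => enorm (sampled_diff (fun _ i => (p i)^-1) f xs A x) ^+ 2)); last first.
  by move=> A; rewrite sqr_ge0.
rewrite lee_fin.
pose g i := grad (f i) x - grad (f i) xs.
have -> : \sum_(A : {set 'I_n})
      enorm (sampled_diff (fun _ i => (p i)^-1) f xs A x) ^+ 2 * law P S A =
    n%:R^-1 ^+ 2 * \sum_i \sum_j pair_incl (law P S) i j / (p i * p j) * dotp (g i) (g j).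
  under eq_bigr => A _.
    rewrite enorm_sqr sampled_diffE dotpZl dotpZr mulrA -expr2 -mulrA.
    over.
  rewrite -mulr_sumr second_moment_pair_incl; congr (_ * _).
  apply: eq_bigr => i _; apply: eq_bigr => j _.
  rewrite dotpZl dotpZr -!mulrA invfM; congr (_ * _).
  by rewrite !mulrA.
have nR0 : 0 < n%:R :> R by rewrite ltr0n.
apply: (@le_trans _ _ (n%:R^-1 ^+ 2 *
  (alpha * dotp (\sum_i g i) (\sum_i g i) + \sum_i beta i * dotp (g i) (g i)))).
  by rewrite ler_wpM2l ?sqr_ge0.
have -> : 2 * (alpha * Lf + M) * bregman (avg_fun f) x xs =
    alpha * (2 * Lf * bregman (avg_fun f) x xs) + 2 * M * bregman (avg_fun f) x xs.
  by move: (bregman _ _ _) => b; ring.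
rewrite [leLHS]mulrDr; apply: lerD.
  have := grad_sqr_le_bregman x xs avg_smooth avg_convex.
  rewrite !(grad_avg df) -scalerBr -sumrB dotpZl dotpZr mulrA -expr2 => h.
  by rewrite mulrCA ler_wpM2l.
rewrite (bregman_avg df) mulrCA expr2 -mulrA ler_pM2l ?invr_gt0 //.
rewrite ler_pdivrMl // !mulr_sumr; apply: ler_sum => i _.
have b0 : 0 <= bregman (f i) x xs.
  have := convex_grad_le xs (x - xs) (f_smooth i) (f_convex i).
  by rewrite [xs + _]addrC subrK /bregman -addrA -opprD subr_ge0.
apply: le_trans (ler_wpM2l (beta0 i) (grad_sqr_le_bregman x xs (f_smooth i) (f_convex i))) _.
move: (bregman _ _ _) b0 => b b0.
have -> : beta i * (2 * L i * b) = 2 * b * (beta i * L i) by ring.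
have -> : n%:R * (2 * M * b) = 2 * b * (n%:R * M) by ring.
by rewrite ler_wpM2l // mulr_ge0.
Qed.

End ExpectedSmoothnessBound.

(** * Nice samplings *)

(** The [k]-subsets of a finite type that contain a given set [B] correspond,
    by removal of [B], to the subsets of its complement of size [k - #|B|]. *)
Lemma card_supersets (I : finType) (B : {set I}) (k : nat) : (#|B| <= k)%N ->
  #|[set A : {set I} | B \subset A & #|A| == k]%SET| = 'C(#|I| - #|B|, k - #|B|).
Proof.
move=> Bk; have <- : #|~: B| = (#|I| - #|B|)%N.
  by rewrite -(cardsC B) addKn.
rewrite -cards_draws -(@card_in_imset _ _ (fun A => A :\: B)%SET).
  apply: eq_card => D; rewrite inE; apply/imsetP/andP => [[A]|[DB /eqP cD]].
    rewrite inE => /andP[BA /eqP cA] ->.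
    by rewrite finset.setDE finset.subsetIr -finset.setDE cardsD (finset.setIidPr BA) cA.
  have BD : (B :&: D = finset.set0)%SET.
    by apply/eqP; rewrite finset.setI_eq0 disjoint_sym finset.disjoints_subset.
  exists (B :|: D)%SET.
    by rewrite inE finset.subsetUl cardsU BD cards0 subn0 cD subnKC /=.
  by rewrite finset.setDUl finset.setDv finset.set0U finset.setDE; apply/esym/finset.setIidPl.
move=> A A'; rewrite !inE => /andP[BA _] /andP[BA' _] AA'.
by rewrite -(finset.setID A B) (finset.setIidPr BA) AA' -{1}(finset.setIidPr BA') finset.setID.
Qed.

Section NiceSampling.
Context {R : realType} {n : nat} (tau : nat) (w : {set 'I_n} -> R).
Hypothesis w_nice : forall A, w A = if #|A| == tau then 'C(n, tau)%:R^-1 else 0.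

Lemma nice_superset_prob (B : {set 'I_n}) : (#|B| <= tau)%N ->
  \sum_(A : {set 'I_n} | B \subset A) w A =
  'C(n - #|B|, tau - #|B|)%:R / 'C(n, tau)%:R.
Proof.
move=> Bt; have := card_supersets Bt; rewrite card_ord => <-.
under eq_bigr do rewrite w_nice.
rewrite -big_mkcondr sumr_const mulrC mulr_natr; congr (_ *+ _).
by apply: eq_card => A; rewrite !inE.
Qed.

(** A nice sampling that includes some index with positive probability has a
    sample size between [1] and [n]; for other sizes the function [w] vanishes
    on the sets containing that index. *)
Lemma nice_size_bounds (i : 'I_n) : 0 < \sum_(A : {set 'I_n} | i \in A) w A ->
  (0 < tau <= n)%N.
Proof.
have [/existsP[A /andP[iA /eqP <-]] _|/existsPn noA] :=
    boolP [exists A : {set 'I_n}, (i \in A) && (#|A| == tau)].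
  have := max_card A; rewrite card_ord => ->; rewrite andbT card_gt0.
  by apply/finset.set0Pn; exists i.
rewrite big1 ?ltxx // => A iA.
by have := noA A; rewrite iA w_nice /= => /negbTE ->.
Qed.

Lemma nice_incl_prob (i : 'I_n) : (0 < tau <= n)%N ->
  \sum_(A : {set 'I_n} | i \in A) w A = tau%:R / n%:R.
Proof.
move=> /andP[t0 tn].
have := @nice_superset_prob [set i]%SET; rewrite cards1 => /(_ t0).
under eq_bigl do rewrite finset.sub1set.
move=> ->; case: tau t0 tn => // m _ mn; rewrite !subn1 /=.
have n0 : (0 < n)%N by apply: leq_trans mn.
have C0 : 'C(n, m.+1)%:R != 0 :> R by rewrite pnatr_eq0 -lt0n bin_gt0.
have N0 : n%:R != 0 :> R by rewrite pnatr_eq0 -lt0n.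
apply/eqP; rewrite eqr_div // mulrC -!natrM; apply/eqP; congr (_%:R).
exact: mul_bin_diag.
Qed.

Lemma nice_pair_incl (i j : 'I_n) : (0 < tau <= n)%N -> i != j ->
  pair_incl w i j = tau%:R * (tau%:R - 1) / (n%:R * (n%:R - 1)).
Proof.
move=> /andP[t0 tn] ij.
have cij : #|[set i; j]%SET| = 2%N by rewrite cards2 ij.
have n2 : (1 < n)%N by rewrite -cij -[X in (_ <= X)%N]card_ord max_card.
have E : pair_incl w i j = \sum_(A : {set 'I_n} | [set i; j]%SET \subset A) w A.
  by apply: eq_bigl => A; rewrite finset.subUset !finset.sub1set.
have [t1|t2] := leqP tau 1.
  (* For tau = 1 no sampled set contains two indices. *)
  have -> : tau = 1%N by apply/eqP; rewrite eqn_leq t1.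
  rewrite subrr mulr0 mul0r E big1 // => A ijA; rewrite w_nice.
  have := subset_leq_card ijA; rewrite cij => cA.
  by case: eqP => // At; move: cA; rewrite At ltnNge t1.
have := @nice_superset_prob [set i; j]%SET; rewrite cij => /(_ t2).
rewrite E => ->; case: tau t2 tn => [|[|m]] // _; case: n n2 => [|[|k]] // _ mk.
have predE (a : nat) : a.+1%:R - 1 = a%:R :> R by rewrite -natr1 addrK.
rewrite !subSS !subn0 !predE.
have C0 : 'C(k.+2, m.+2)%:R != 0 :> R by rewrite pnatr_eq0 -lt0n bin_gt0.
have N0 : k.+2%:R * k.+1%:R != 0 :> R by rewrite -natrM pnatr_eq0.
apply/eqP; rewrite eqr_div // -!natrM; apply/eqP; congr (_%:R).
have e1 := mul_bin_diag k.+2 m.+1; have e2 := mul_bin_diag k.+1 m.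
rewrite /= in e1 e2.
by rewrite mulnC -mulnA e2 mulnCA e1 mulnCA mulnA.
Qed.

End NiceSampling.

(** * Group samplings *)

Section GroupSampling.
Context {R : realType} {n : nat}.
Variables (p : 'I_n -> R) (C : {set {set 'I_n}}) (w : {set 'I_n} -> R).
Hypotheses (Cpart : finset.partition C [set: 'I_n]%SET)
  (p_gt0 : forall i, 0 < p i).
Hypotheses (w_diag : forall i, pair_incl w i i = p i)
  (w_same : forall i j : 'I_n, i != j -> j \in finset.pblock C i -> pair_incl w i j = 0)
  (w_other : forall i j : 'I_n, j \notin finset.pblock C i -> pair_incl w i j = p i * p j).

(** Within a block [B], the off-diagonal terms are missing from the quadratic
    form; they add up to [|\sum_(i in B) g i|^2 - \sum_(i in B) |g i|^2]. This is [0] for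
    a singleton block, and bounded below by dropping the square otherwise. *)
Lemma group_quadratic_le d (g : 'I_n -> 'cV[R]_d) :
  \sum_i \sum_j pair_incl w i j / (p i * p j) * dotp (g i) (g j) <=
  1 * dotp (\sum_i g i) (\sum_i g i) +
  \sum_i ((p i)^-1 - (isolated_index C i)%:R) * dotp (g i) (g i).
Proof.
have p0 i : p i != 0 by rewrite gt_eqF.
have coverC i : i \in finset.cover C by rewrite (cover_partition Cpart) inE.
have tC := partition_trivIset Cpart.
have rowE i : \sum_j pair_incl w i j / (p i * p j) * dotp (g i) (g j) =
    \sum_j dotp (g i) (g j) + (p i)^-1 * dotp (g i) (g i) -
    \sum_(j in finset.pblock C i) dotp (g i) (g j).
  rewrite [X in _ = X + _ - _](bigID [in finset.pblock C i]) /=.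
  rewrite [X in _ = X + _ - _]addrC addrAC addrK [RHS]addrC.
  rewrite (bigID [in finset.pblock C i]) /=; congr (_ + _).
    rewrite (bigD1 i) /= ?mem_pblock // big1 ?addr0 => [|j /andP[ij ji]].
      by rewrite w_diag invfM mulrA divff // mul1r.
    by rewrite w_same ?mul0r // eq_sym.
  by apply: eq_bigr => j ij; rewrite w_other // divff ?mul1r // mulf_neq0.
under eq_bigr do rewrite rowE.
rewrite sumrB big_split /= mul1r dotp_suml -!addrA.
rewrite lerD //; first by under eq_bigr do rewrite -dotp_sumr.
under [leRHS]eq_bigr do rewrite mulrBl.
rewrite sumrB lerB //.
have blockE (F : 'I_n -> R) : \sum_i F i = \sum_(B in C) \sum_(i in B) F i.
  by rewrite -(set_partition_big _ Cpart); apply: eq_bigl => i; rewrite inE.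
rewrite !blockE; apply: ler_sum => B BC.
have -> : \sum_(i in B) \sum_(j in finset.pblock C i) dotp (g i) (g j) =
    dotp (\sum_(i in B) g i) (\sum_(i in B) g i).
  rewrite dotp_suml; apply: eq_bigr => i iB.
  by rewrite dotp_sumr (def_pblock tC BC iB).
(* A block that contains an isolated index is a singleton. *)
have [/existsP[i /andP[iB iI]]|/existsPn noI] :=
    boolP [exists i, (i \in B) && isolated_index C i].
  have -> : B = [set i]%SET.
    by rewrite -(def_pblock tC BC iB); apply: def_pblock; rewrite ?inE.
  by rewrite !big_set1 iI mul1r.
rewrite big1 ?dotp_ge0 // => i iB.
by have := noI i; rewrite iB /= => /negbTE ->; rewrite mul0r.
Qed.

End GroupSampling.

Section GroupSamplingLaw.
Context {R : realType} {n : nat}.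
Context {dT : measure_display} {T : measurableType dT} (P : probability T R).
Variables (S : T -> {set 'I_n}) (p : 'I_n -> R) (C : {set {set 'I_n}}).
Hypotheses (S_random : random_subset S)
  (p_def : forall i, P [set w | i \in S w] = (p i)%:E)
  (S_group : group_sampling P p C S).

Lemma incl_probE i : \sum_(A : {set 'I_n} | i \in A) law P S A = p i.
Proof.
have := prob_finite_valued P S_random (fun A => i \in A).
by rewrite p_def => -[].
Qed.

Lemma pair_incl_diag i : pair_incl (law P S) i i = p i.
Proof. by rewrite -incl_probE; apply: eq_bigl => A; rewrite andbb. Qed.

(** The event that [i] is the index chosen from its block already has
    probability [p i], so no second index of the block is chosen with [i]. *)
Lemma group_pair_incl_same (i j : 'I_n) : i != j -> j \in finset.pblock C i ->
  pair_incl (law P S) i j = 0.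
Proof.
have [p01 [Cpart _] _ S_one _] := S_group.
move=> ij jB; set B := finset.pblock C i in jB *.
have iC : i \in finset.cover C by rewrite (cover_partition Cpart) inE.
have iB : i \in B by rewrite mem_pblock.
have sum_gt0 : 0 < \sum_(s in B) p s.
  rewrite (bigD1 i) //= ltr_pwDl //; first by have /andP[] := p01 i.
  by apply: sumr_ge0 => s _; have /andP[/ltW] := p01 s.
have one : \sum_(A | (A :&: B == [set i])%SET) law P S A = p i.
  have := prob_finite_valued P S_random (fun A => A :&: B == [set i])%SET.
  have -> : [set w | (S w :&: B == [set i])%SET] = [set w | (S w :&: B)%SET = [set i]%SET].
    by apply/seteqP; split => w /eqP.
  rewrite S_one ?pblock_mem // mulrC divfK; last by rewrite gt_eqF.
  by case=> <-.
have := incl_probE i; rewrite (bigID (fun A : {set 'I_n} => A :&: B == [set i])%SET) /=.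
have -> : \sum_(A : {set 'I_n} | (i \in A) && (A :&: B == [set i])%SET) law P S A = p i.
  rewrite -one; apply: eq_bigl => A; rewrite andb_idl // => /eqP AB.
  have : i \in (A :&: B)%SET by rewrite AB inE.
  by rewrite inE => /andP[].
move/eqP; rewrite -subr_eq0 addrAC subrr add0r => /eqP rest0.
apply: big1 => A /andP[iA jA]; apply: (psumr_eq0P _ rest0).
  by move=> ? _; exact: law_ge0.
rewrite iA /=; apply/eqP => AB.
have : j \in (A :&: B)%SET by rewrite inE jA.
by rewrite AB inE eq_sym (negbTE ij).
Qed.

(** Indices of different blocks are sampled independently. *)
Lemma group_pair_incl_other (i j : 'I_n) : j \notin finset.pblock C i ->
  pair_incl (law P S) i j = p i * p j.
Proof.
have [_ [Cpart _] S_indep _ _] := S_group.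
move=> jB; set B := finset.pblock C i in jB *; set B' := finset.pblock C j.
have coverC k : k \in finset.cover C by rewrite (cover_partition Cpart) inE.
have iB : i \in B by rewrite mem_pblock.
have jB' : j \in B' by rewrite mem_pblock.
have BB' : B != B' by apply: contraNneq jB => ->.
have := S_indep [set B; B']%SET
  (fun D => if D == B then [set U : {set 'I_n} | i \in U]%SET
            else [set U : {set 'I_n} | j \in U]%SET).
rewrite finset.subUset !finset.sub1set !pblock_mem // => /(_ isT).
have -> : [set w | forall D, D \in [set B; B']%SET -> (S w :&: D)%SET \in
    (if D == B then [set U : {set 'I_n} | i \in U]%SET
     else [set U : {set 'I_n} | j \in U]%SET)] =
    [set w | (i \in S w) && (j \in S w)].
  apply/seteqP; split => w /=.
    move=> H; have := H B; have := H B'.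
    rewrite !inE !eqxx orbT [B' == B]eq_sym (negbTE BB') !inE => /(_ isT) /andP[-> _].
    by move=> /(_ isT) /andP[-> _].
  move=> /andP[iS jS] D; rewrite !inE => /orP[|] /eqP ->.
    by rewrite eqxx !inE iS.
  by rewrite eq_sym (negbTE BB') !inE jS.
rewrite (prob_finite_valued P S_random (fun A => (i \in A) && (j \in A))) => H.
apply: EFin_inj; rewrite [LHS]H big_setU1 ?inE //= big_set1 eqxx eq_sym (negbTE BB').
rewrite EFinM -!p_def; congr (P _ * P _)%E; apply/seteqP; split => w /=; rewrite !inE.
- by case/andP.
- by move=> ->.
- by case/andP.
- by move=> ->.
Qed.

End GroupSamplingLaw.

(** * The bounds on the expected smoothness constant *)

Lemma EFin_of_between (R : realType) (M : \bar R) (a : R) :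
  0 <= a -> (a%:E <= M)%E -> (M < +oo)%E -> exists2 m : R, 0 <= m & M = m%:E.
Proof.
by case: M => [m||] //= a0; rewrite lee_fin => am _; exists m => //; exact: le_trans am.
Qed.

Theorem lemmaF2 (R : realType) (d n : nat) (hn : (0 < n)%N)
    (f : 'I_n -> 'cV[R]_d -> R) (L : 'I_n -> R) (Lf : R)
    (f_smooth : forall i, smooth (L i) (f i))
    (f_convex : forall i, convex_function [set: 'cV[R]_d] (f i))
    (avg_smooth : smooth Lf (avg_fun f))
    (avg_convex : convex_function [set: 'cV[R]_d] (avg_fun f))
    (psi : 'cV[R]_d -> \bar R)
    (psi_proper : proper_fun psi) (psi_closed : closed_fun psi)
    (psi_convex : econvex psi)
    (xs : 'cV[R]_d)
    (xs_min : global_minimizer (fun x => (avg_fun f x)%:E + psi x)%E xs)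
    (dT : measure_display) (T : measurableType dT) (P : probability T R)
    (S : T -> {set 'I_n}) (S_random : random_subset S)
    (p : 'I_n -> R)
    (p_def : forall i, P [set w | i \in S w] = (p i)%:E)
    (S_proper : forall i, 0 < p i) :
  let L1 := expected_smoothness P S (fun _ i => (p i)^-1) f xs in
  (forall tau : nat, (1 < n)%N -> nice_sampling P tau S ->
    (L1 <=
      (n%:R * (tau%:R - 1) / (tau%:R * (n%:R - 1)) * Lf)%:E +
      ((n%:R - tau%:R) / (tau%:R * (n%:R - 1)))%:E *
        \big[maxe/-oo]_(i < n) (L i)%:E)%E) /\
  (forall C : {set {set 'I_n}}, group_sampling P p C S ->
    (L1 <=
      Lf%:E +
      (n%:R^-1)%:E *
        maxe (\big[maxe/-oo]_(i < n | isolated_index C i) (((p i)^-1 - 1) * L i)%:E)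
             (\big[maxe/-oo]_(i < n | ~~ isolated_index C i) (L i / p i)%:E))%E).
Proof.
move=> L1.
have n0R : 0 < n%:R :> R by rewrite ltr0n.
have L0 i : 0 <= L i by have [] := f_smooth i.
have i0 : 'I_n by exact: Ordinal hn.
have inclE := incl_probE S_random p_def.
split=> [tau n1 S_nice|C S_group].
- have w_nice (A : {set 'I_n}) : law P S A = if #|A| == tau then 'C(n, tau)%:R^-1 else 0.
    by rewrite /law S_nice.
  have tau01 : (0 < tau <= n)%N.
    by apply: (nice_size_bounds w_nice (i := i0)); rewrite inclE.
  have pE i : p i = tau%:R / n%:R by rewrite -inclE (nice_incl_prob w_nice).
  have /andP[t0 tn] := tau01.
  have t0R : 0 < tau%:R :> R by rewrite ltr0n.
  have n1R : 0 < n%:R - 1 :> R by rewrite subr_gt0 ltr1n.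
  have tn0 : 0 <= n%:R - tau%:R :> R by rewrite subr_ge0 ler_nat.
  have t1 : 0 <= tau%:R - 1 :> R by rewrite subr_ge0 ler1n.
  have [m m0 mE] : exists2 m : R, 0 <= m & (\big[maxe/-oo]_(i < n) (L i)%:E)%E = m%:E.
    apply: (EFin_of_between (L0 i0)); first exact: le_bigmax.
    by apply: bigmax_lt => // i _; rewrite ltry.
  have Lm i : L i <= m by rewrite -lee_fin -mE; exact: le_bigmax.
  rewrite mE -EFinM -EFinD.
  apply: (expected_smoothness_le hn f_smooth f_convex avg_smooth avg_convex S_random
    (beta := fun=> n%:R * ((n%:R - tau%:R) / (tau%:R * (n%:R - 1))))).
  + by rewrite divr_ge0 ?mulr_ge0 // ltW.
  + by move=> _; rewrite mulr_ge0 ?divr_ge0 ?mulr_ge0 // ltW.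
  + by rewrite mulr_ge0 ?divr_ge0 ?mulr_ge0 // ltW.
  + by move=> i; rewrite -mulrA ler_wpM2l ?ler_wpM2l ?divr_ge0 ?mulr_ge0 // ltW.
  move=> g; rewrite dotp_suml mulr_sumr -big_split /=; apply: ler_sum => i _.
  rewrite dotp_sumr (bigD1 i) //= [X in _ <= _ * X + _](bigD1 i) //=.
  rewrite mulrDr addrAC; apply: lerD.
    rewrite -mulrDl.
    suff -> : pair_incl (law P S) i i = p i.
      rewrite !pE le_eqVlt; apply/orP; left; apply/eqP; congr (_ * _).
      by field; rewrite !gt_eqF.
    exact: pair_incl_diag.
  rewrite mulr_sumr; apply: ler_sum => j ji.
  rewrite (nice_pair_incl w_nice) 1?eq_sym // !pE.
  rewrite le_eqVlt; apply/orP; left; apply/eqP; congr (_ * _).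
  by field; rewrite !gt_eqF.
have [p01 [Cpart _] _ _ _] := S_group.
set M := maxe _ _.
have p1 i : p i <= 1 by have /andP[] := p01 i.
(* F i is the i-th term of the maximum, whether i is isolated or not. *)
pose F i := ((p i)^-1 - (isolated_index C i)%:R) * L i.
have beta0 i : 0 <= (p i)^-1 - (isolated_index C i)%:R.
  rewrite subr_ge0 (@le_trans _ _ 1) ?lern1 ?leq_b1 //.
  by rewrite invf_ge1.
have FM i : ((F i)%:E <= M)%E.
  rewrite le_max /F; case: (boolP (isolated_index C i)) => iI; apply/orP; [left|right].
    exact: (@le_bigmax_cond _ _ _ _ i (isolated_index C) (fun i => (((p i)^-1 - 1) * L i)%:E)).
  rewrite subr0 mulrC.
  exact: (@le_bigmax_cond _ _ _ _ i (fun i => ~~ isolated_index C i)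
    (fun i => (L i / p i)%:E)).
have [m m0 mE] : exists2 m : R, 0 <= m & M = m%:E.
  apply: (EFin_of_between _ (FM i0)); first by rewrite mulr_ge0.
  by rewrite gt_max; apply/andP; split; apply: bigmax_lt => // i _; rewrite ltry.
rewrite mE -EFinM -EFinD -[Lf]mul1r.
apply: (expected_smoothness_le hn f_smooth f_convex avg_smooth avg_convex S_random
  (beta := fun i => (p i)^-1 - (isolated_index C i)%:R)) => //.
- by rewrite mulr_ge0 // invr_ge0 ltW.
- by move=> i; rewrite mulVKf ?gt_eqF // -lee_fin -mE; exact: FM.
move=> g; apply: group_quadratic_le => //.
- by move=> i; exact: pair_incl_diag.
- by move=> i j; apply: (group_pair_incl_same (p := p)).
- by move=> i j; apply: group_pair_incl_other.
Qed.
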